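(* There is a constant $C\in(0,\infty)$ such that for every $d\ge 4$, every integer $N\ge 1$, and every nearest neighbor path $\mathcal{P}=(P_0,P_1,\dots,P_K)\subset\mathbb{Z}^d$ connecting $0$ and $\partial B_1(0,N)$, if $\{X_n\}_{n=0}^\infty$ is a $d$-dimensional simple random walk starting at $0$, then $$P\left(\mathrm{Trace}(\mathcal{P})\subseteq \mathrm{Trace}\big(\{X_n\}_{n=0}^\infty\big)\right)\le \left(\frac{C}{d}\right)^N.$$
   Context: $\partial B_1(0,N)=\{x\in\mathbb{Z}^d:\|x\|_1=N\}$. A nearest neighbor path $\mathcal{P}=(P_0,\dots,P_K)$ (consecutive points at $L_1$-distance $1$) connects $0$ and $\partial B_1(0,N)$ if $P_0=0$ and $\inf\{n:\|P_n\|_1=N\}=K$. $\mathrm{Trace}$ of a (finite or infinite) sequence of points is the set of points appearing in it. $d$-dimensional simple random walk moves at each step to one of the $2d$ nearest neighbors with equal probability, independently. *)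

(* Defs.v *)
From HB Require Import structures.
From mathcomp Require Import all_boot all_order all_algebra.
From mathcomp Require Import finmap.
From mathcomp Require Import all_classical all_reals all_analysis.

Set Implicit Arguments.
Unset Strict Implicit.
Unset Printing Implicit Defensive.

Import Order.TTheory GRing.Theory Num.Theory.

Local Open Scope classical_set_scope.
Local Open Scope ring_scope.

(* An alias of 'rV[int]_d, so that it can carry the discrete sigma-algebra. *)
Definition lattice (d : nat) : Type := 'rV[int]_d.

HB.instance Definition _ (d : nat) := GRing.Zmodule.on (lattice d).
HB.instance Definition _ (d : nat) := isPointed.Build (lattice d) 0.
HB.instance Definition _ (d : nat) :=
  @isMeasurable.Build default_measure_display (lattice d)
    (@discrete_measurable (lattice d)) (@discrete_measurable0 (lattice d))
    (@discrete_measurableC (lattice d)) (@discrete_measurableU (lattice d)).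

Definition l1norm (d : nat) (x : lattice d) : nat :=
  (\sum_(i < d) `|(x : 'rV[int]_d) ord0 i|)%N.

Definition l1sphere (d N : nat) : set (lattice d) :=
  [set x | l1norm x = N].

Definition nearest_neighbor_path (d K : nat) (p : 'I_K.+1 -> lattice d) : Prop :=
  forall i j : 'I_K.+1, j = i.+1 :> nat -> l1norm (p j - p i) = 1%N.

(* The last two clauses say that inf {n | p n \in l1sphere d N} = K. *)
Definition connects_origin_to_sphere (d N K : nat) (p : 'I_K.+1 -> lattice d) :
    Prop :=
  [/\ p ord0 = 0,
      l1sphere N (p ord_max) &
      forall i : 'I_K.+1, l1sphere N (p i) -> (K <= i)%N].

Definition mutually_independent (disp disp' : measure_display)
    (T : measurableType disp) (T' : measurableType disp') (R : realType)
    (P : probability T R) (I : choiceType) (Y : I -> T -> T') : Prop :=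
  forall (J : {fset I}) (A : I -> set T'), (forall i, measurable (A i)) ->
    P (\bigcap_(i in [set` J]) (Y i @^-1` A i)) =
    (\prod_(i <- J) P (Y i @^-1` A i))%E.

Definition increment (T : Type) (d : nat) (X : nat -> T -> lattice d)
    (n : nat) (w : T) : lattice d := X n.+1 w - X n w.

(* There are 2d lattice points of norm 1, so the second clause also forces the
   increments to be almost surely of norm 1. *)
Definition simple_random_walk_from_origin (disp : measure_display)
    (T : measurableType disp) (R : realType) (P : probability T R) (d : nat)
    (X : nat -> {RV P >-> lattice d}) : Prop :=
  [/\ P (X 0%N @^-1` [set 0]) = 1%E,
      forall (n : nat) (e : lattice d), l1norm e = 1%N ->
        P (increment X n @^-1` [set e]) = ((2 * d)%:R^-1)%:E &
      mutually_independent P (increment X)].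

(* Main.v *)
Require Import Defs.
From HB Require Import structures.
From mathcomp Require Import all_boot all_order all_algebra.
From mathcomp Require Import finmap.
From mathcomp Require Import all_classical all_reals all_analysis.
From mathcomp Require Import ring lra zify.

(** Only large dimensions matter: when [d] is smaller than the constant [486],
    the claimed bound is at least [1].

    A path from the origin to the sphere of radius [N] changes its norm by at
    most one per step, so it contains a point of each norm [1, ..., N]
    ([path_meets_spheres]); it is enough to bound the probability of visiting
    these [N] points.

    The function [potential], equal to [1] at the origin and to
    [1 / (d |z|_2^4)] elsewhere, is superharmonic away from the origin when [d]
    is large ([potential_superharmonic]), so the walk started at [x] hits [y]
    with probability at most [potential (x - y)].  Hence it visits a finite set
    [s] with probability at most the sum, over all orders of visit [y_1, y_2,
    ..., y_n], of the products of the [potential (y_i - y_(i+1))], with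
    [y_0 = x]; this sum is [cover_bound s x].  The proof of this bound
    is global rather than hit by hit: [cover_bound s] is superharmonic off [s]
    ([cover_bound_superharmonic]) and does not increase when a point of [s] is
    crossed out on being visited ([cover_bound_rem]), so evaluating it at the
    current position and the current set of unvisited points gives a
    supermartingale, whose value is [1] once everything has been visited
    ([probability_history_visited], [probability_cover_le]).

    There are [N!] orders of visit, but the sum over them is harmless: since
    [|z|_2^2 >= |z|_1] on the lattice, the [potential]s from one of the points
    to all the others sum to at most [(1 / d) * 2 * (1 + 1/4 + 1/9 + ...)],
    hence to at most [4 / d] ([sum_potential_le]).  Summing out the last point
    of the order, then the one before it, and so on gives
    [cover_bound s 0 <= (4 / d) ^ N] ([cover_bound_le]). *)

Set Implicit Arguments.
Unset Strict Implicit.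
Unset Printing Implicit Defensive.

Import Order.TTheory GRing.Theory Num.Theory.

Local Open Scope classical_set_scope.
Local Open Scope ring_scope.

(** * Lattice vectors *)

Definition coord (d : nat) (z : lattice d) (i : 'I_d) : int :=
  (z : 'rV[int]_d) ord0 i.

Definition step (d : nat) (b : bool) (i : 'I_d) : lattice d :=
  (-1) ^+ b *: (delta_mx ord0 i : 'rV[int]_d).

Definition sqnorm (d : nat) (z : lattice d) : int :=
  \sum_(i < d) coord z i ^+ 2.

Lemma coordD (d : nat) (x y : lattice d) i :
  coord (x + y) i = coord x i + coord y i.
Proof. exact: mxE. Qed.

Lemma coordN (d : nat) (x : lattice d) i : coord (- x) i = - coord x i.
Proof. exact: mxE. Qed.

Lemma coord0 (d : nat) i : coord (0 : lattice d) i = 0.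
Proof. exact: mxE. Qed.

Lemma coord_step (d : nat) b (i j : 'I_d) :
  coord (step b i) j = (-1) ^+ b * (j == i)%:R.
Proof. by rewrite /coord /step !mxE eqxx. Qed.

Lemma l1normE (d : nat) (z : lattice d) :
  l1norm z = (\sum_(i < d) `|coord z i|)%N.
Proof. by []. Qed.

Lemma l1norm_eq0 (d : nat) (z : lattice d) : (l1norm z == 0%N) = (z == 0).
Proof.
apply/idP/eqP => [|->]; last first.
  by rewrite l1normE big1 // => i _; rewrite coord0.
rewrite l1normE sum_nat_eq0 => /forallP z0.
apply/matrixP => a i; rewrite ord1 [RHS]mxE.
by have := z0 i; rewrite /= absz_eq0 => /eqP.
Qed.

Lemma l1norm_step (d : nat) b (i : 'I_d) : l1norm (step b i) = 1%N.
Proof.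
rewrite l1normE (bigD1 i) //= coord_step eqxx mulr1 big1 => [|j ji].
  by case: b.
by rewrite coord_step (negPf ji) mulr0.
Qed.

Lemma step_inj (d : nat) (u v : bool * 'I_d) :
  step u.1 u.2 = step v.1 v.2 -> u = v.
Proof.
case: u v => [b i] [c j] /= bicj.
have := congr1 (fun z => coord z i) bicj.
rewrite /= !coord_step eqxx mulr1.
case: eqVneq => [<-|_]; last by case: b {bicj}; rewrite ?mulr0.
by case: b c {bicj} => [] [].
Qed.

Lemma l1norm_sub (d : nat) (x y : lattice d) :
  (l1norm x <= l1norm (x - y)%R + l1norm y)%N.
Proof.
rewrite !l1normE -big_split /=; apply: leq_sum => i _.
by rewrite coordD coordN; lia.
Qed.

Lemma l1normN (d : nat) (x : lattice d) : l1norm (- x) = l1norm x.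
Proof. by rewrite !l1normE; apply: eq_bigr => i _; rewrite coordN abszN. Qed.

Lemma l1norm_distB (d : nat) (x y : lattice d) :
  `|(l1norm x)%:Z - (l1norm y)%:Z| <= (l1norm (x - y))%:Z.
Proof.
have xy : (l1norm x <= l1norm (x - y)%R + l1norm y)%N by exact: l1norm_sub.
have yx : (l1norm y <= l1norm (x - y)%R + l1norm x)%N.
  by rewrite -(l1normN (x - y)) opprB l1norm_sub.
rewrite ler_norml; apply/andP; split; lia.
Qed.

(** A nonzero integer is at most its square in absolute value. *)
Lemma l1norm_le_sqnorm (d : nat) (z : lattice d) :
  (l1norm z)%:Z <= sqnorm z.
Proof.
rewrite l1normE /sqnorm (raddf_sum Posz) ler_sum // => i _ /=.
nia.
Qed.

Lemma sqnorm_gt0 (d : nat) (z : lattice d) : z != 0 -> 0 < sqnorm z.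
Proof.
rewrite -l1norm_eq0 => z0; apply: lt_le_trans (l1norm_le_sqnorm z).
by rewrite ltz_nat lt0n.
Qed.

Lemma coord_sqr_le (d : nat) (z : lattice d) i : coord z i ^+ 2 <= sqnorm z.
Proof.
rewrite /sqnorm (bigD1 i) //= lerDl sumr_ge0 // => j _; exact: sqr_ge0.
Qed.

Lemma sqnorm_step (d : nat) (z : lattice d) b i :
  sqnorm (z + step b i) = sqnorm z + 1 + (-1) ^+ b * 2 * coord z i.
Proof.
rewrite /sqnorm (bigD1 i) //= [in RHS](bigD1 i) //=.
rewrite (eq_bigr (fun j => coord z j ^+ 2)) => [|j ji].
  by rewrite coordD coord_step eqxx mulr1; case: b; rewrite ?expr1 ?expr0; ring.
by rewrite coordD coord_step (negPf ji) mulr0 addr0.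
Qed.

(** * A superharmonic function *)

(** The exponent makes the function summable along points of distinct l1 norms,
    and the factor [1 / d] is the order of the probability [1 / (2 d)] of
    hitting the origin from a neighbour in one step. *)
Definition potential (R : realType) (d : nat) (z : lattice d) : R :=
  if z == 0 then 1 else (d%:R * (sqnorm z)%:~R ^+ 2)^-1.

Lemma potential0 (R : realType) (d : nat) : potential R (0 : lattice d) = 1.
Proof. by rewrite /potential eqxx. Qed.

Lemma potentialE (R : realType) (d : nat) (z : lattice d) : z != 0 ->
  potential R z = (d%:R * (sqnorm z)%:~R ^+ 2)^-1.
Proof. by rewrite /potential => /negPf ->. Qed.

Lemma potential_ge0 (R : realType) (d : nat) (z : lattice d) :
  0 <= potential R z.
Proof.
by rewrite /potential; case: ifP => // _; rewrite invr_ge0 mulr_ge0 // sqr_ge0.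
Qed.

(** With [s = r + 1] and [u = 4 t^2 / s^2], the left-hand side is
    [(2 / s^2) (1 + u) / (1 - u)^2].  The constraints give [u <= 8 / 9], hence
    [(1 + u) / (1 - u)^2 <= 1 + 3 u / (1 - u)^2 <= 1 + 243 u], and
    [1944 = 2 * 4 * 243]. *)
Lemma inv_sqr_pair_le (R : realFieldType) (r t : R) : 2 <= r -> t ^+ 2 <= r ->
  ((r + 1 + 2 * t) ^+ 2)^-1 + ((r + 1 - 2 * t) ^+ 2)^-1 <=
  2 / (r + 1) ^+ 2 + 1944 * t ^+ 2 / (r + 1) ^+ 4.
Proof.
move=> r2 tr; set s := r + 1.
have s0 : 0 < s by rewrite /s; lra.
set u := 4 * t ^+ 2 / s ^+ 2.
have u0 : 0 <= u by apply: divr_ge0; [apply: mulr_ge0|]; rewrite ?sqr_ge0.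
have u8 : u <= 8 / 9.
  rewrite /u ler_pdivrMr ?exprn_gt0 // /s; nra.
have abE : (s + 2 * t) * (s - 2 * t) = s ^+ 2 * (1 - u).
  by rewrite /u; field; rewrite gt_eqF.
have ab0 : 0 < s ^+ 2 * (1 - u) by rewrite mulr_gt0 ?exprn_gt0 //; lra.
have ab_neq0 : (s + 2 * t) * (s - 2 * t) != 0 by rewrite abE gt_eqF.
have [a0 b0] : s + 2 * t != 0 /\ s - 2 * t != 0.
  by move: ab_neq0; rewrite mulf_eq0 negb_or => /andP[].
have u1 : 1 - u != 0 by rewrite gt_eqF //; lra.
have -> : ((s + 2 * t) ^+ 2)^-1 + ((s - 2 * t) ^+ 2)^-1 =
    2 / s ^+ 2 * ((1 + u) / (1 - u) ^+ 2).
  transitivity (2 * (s ^+ 2 + 4 * t ^+ 2) / ((s + 2 * t) * (s - 2 * t)) ^+ 2).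
    by field; rewrite a0 b0.
  rewrite abE; have -> : 4 * t ^+ 2 = u * s ^+ 2.
    by rewrite /u divfK // expf_neq0 // gt_eqF.
  by field; rewrite u1 gt_eqF.
have -> : 2 / s ^+ 2 + 1944 * t ^+ 2 / s ^+ 4 = 2 / s ^+ 2 * (1 + 243 * u).
  by rewrite /u; field; rewrite gt_eqF.
apply: ler_wpM2l; first by rewrite divr_ge0 ?sqr_ge0.
rewrite ler_pdivrMr; last by rewrite exprn_gt0 //; lra.
have v1 : 1 / 81 <= (1 - u) ^+ 2 by nra.
have v2 : 1 - 2 * u <= (1 - u) ^+ 2 by nra.
nra.
Qed.

(** At a point of squared norm [1] exactly one neighbour is the origin: it lies
    in direction [(b, i)] when [coord z i = - (-1) ^+ b], and the last summand
    is the indicator of that event. *)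
Lemma potential_step_norm1 (R : realType) (d : nat) (z : lattice d) b i :
  (0 < d)%N -> sqnorm z = 1 ->
  potential R (z + step b i) <=
  (4 * d%:R)^-1 + (coord z i ^+ 2 - (-1) ^+ b * coord z i)%:~R / 2.
Proof.
move=> d0 z1.
have d1 : 0 < d%:R :> R by rewrite ltr0n.
have t1 : coord z i ^+ 2 <= 1 by rewrite -z1 coord_sqr_le.
have [zs|zs] := eqVneq (z + step b i) 0.
  have -> : coord z i ^+ 2 - (-1) ^+ b * coord z i = 2.
    have := congr1 (@coord d ^~ i) zs; rewrite /= coordD coord_step eqxx coord0.
    by case: b {zs}; rewrite ?expr1 ?expr0; nia.
  by rewrite zs potential0 divff ?pnatr_eq0 // lerDr invr_ge0 mulr_ge0.
have q2 : 2 <= sqnorm (z + step b i).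
  (* The squared norm of the neighbour is positive and even. *)
  have := sqnorm_gt0 zs; rewrite sqnorm_step z1.
  by case: b {zs}; rewrite ?expr1 ?expr0; lia.
have q2R : 2 <= (sqnorm (z + step b i))%:~R :> R by rewrite (ler_int R 2).
rewrite potentialE // (le_trans (y := (4 * d%:R)^-1)) //.
  set q := (sqnorm _)%:~R in q2R *.
  have q4 : 4 <= q ^+ 2 by nra.
  by rewrite lef_pV2 ?posrE; nra.
have ind0 : 0 <= coord z i ^+ 2 - (-1) ^+ b * coord z i.
  by move: t1; case: b {zs q2 q2R}; rewrite ?expr1 ?expr0; nia.
by rewrite lerDl divr_ge0 // ler0z.
Qed.

Lemma potential_step_pair (R : realType) (d : nat) (z : lattice d) i :
  (0 < d)%N -> 2 <= sqnorm z ->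
  potential R (z + step true i) + potential R (z + step false i) <=
  d%:R^-1 * (2 / ((sqnorm z)%:~R + 1) ^+ 2 +
             1944 / ((sqnorm z)%:~R + 1) ^+ 4 * (coord z i ^+ 2)%:~R).
Proof.
move=> d0 z2.
have d1 : 0 < d%:R :> R by rewrite ltr0n.
have nz b : z + step b i != 0.
  apply/negP => /eqP /(congr1 (@sqnorm d)).
  rewrite sqnorm_step [X in _ = X]/sqnorm big1 => [|j _]; last first.
    by rewrite coord0 expr0n.
  have := coord_sqr_le z i.
  by case: b; rewrite ?expr1 ?expr0; nia.
have potE b : potential R (z + step b i) =
    d%:R^-1 * (((sqnorm z)%:~R + 1 + (-1) ^+ b * 2 * (coord z i)%:~R) ^+ 2)^-1.
  rewrite potentialE // invfM sqnorm_step; congr (_ * (_ ^+ 2)^-1).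
  by case: b; rewrite ?expr1 ?expr0; ring.
rewrite !potE -mulrDr ler_pM2l ?invr_gt0 //.
rewrite expr1 expr0 addrC mul1r mulN1r mulNr.
rewrite rmorphXn /=.
have z2R : 2 <= (sqnorm z)%:~R :> R by rewrite (ler_int R 2).
have tz : (coord z i)%:~R ^+ 2 <= (sqnorm z)%:~R :> R.
  have -> : (coord z i)%:~R ^+ 2 = (coord z i ^+ 2)%:~R :> R.
    by rewrite rmorphXn.
  by rewrite ler_int coord_sqr_le.
have := inv_sqr_pair_le z2R tz.
by rewrite mulrAC.
Qed.

Lemma sum_coord_sqr (R : realType) (d : nat) (z : lattice d) :
  \sum_(i < d) (coord z i ^+ 2)%:~R = (sqnorm z)%:~R :> R.
Proof. by rewrite -rmorph_sum. Qed.

(** With [r = |z|_2^2 >= 2], the neighbours of [z] in the two directions of the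
    [i]-th axis have squared norms [r + 1 + 2 z_i] and [r + 1 - 2 z_i].  The
    average over all axes gains a term of order [1 / r^3] from the shift
    [r -> r + 1] and loses, by convexity, a term of order
    [(1 / d) * (sum of the z_i^2) / r^4 = 1 / (d r^3)], so the gain wins for
    large [d].  The norm [1] case is separate because the origin is then a
    neighbour. *)
Lemma potential_superharmonic (R : realType) (d : nat) (z : lattice d) :
  (486 <= d)%N -> z != 0 ->
  ((2 * d)%:R^-1) * (\sum_(u : bool * 'I_d) potential R (z + step u.1 u.2)) <=
  potential R z.
Proof.
move=> d486 z0.
have d0 : (0 < d)%N by lia.
have dR : 486 <= d%:R :> R by rewrite (ler_nat R 486).
have d1 : 0 < d%:R :> R by lra.
rewrite mulrC ler_pdivrMr ?ltr0n ?muln_gt0 // natrM.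
rewrite -(pair_bigA _ (fun b i => potential R (z + step b i))) /= big_bool /=.
rewrite -big_split /= potentialE //.
have [z1|z1] := eqVneq (sqnorm z) 1.
  (* All neighbours together contribute at most [3 / 2], out of the allowed
     [2 * d * potential z = 2]. *)
  apply: (le_trans (y := \sum_(i < d) (2 * (4 * d%:R)^-1 +
                                       (coord z i ^+ 2)%:~R))).
    apply: ler_sum => i _.
    have := potential_step_norm1 R true i d0 z1.
    have := potential_step_norm1 R false i d0 z1.
    rewrite !rmorphB !rmorphM /= expr1 expr0 => hf ht; lra.
  rewrite big_split /= sumr_const card_ord sum_coord_sqr z1 -[_ *+ d]mulr_natl.
  have -> : d%:R * (2 * (4 * d%:R)^-1) = 1 / 2 :> R by field; rewrite gt_eqF.
  by rewrite expr1n mulr1 [leRHS]mulrC mulfK ?gt_eqF //; lra.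
have z2 : 2 <= sqnorm z by have := sqnorm_gt0 z0; lia.
have z2R : 2 <= (sqnorm z)%:~R :> R by rewrite (ler_int R 2).
apply: le_trans (ler_sum _ (fun i _ => potential_step_pair R i d0 z2)) _.
rewrite -mulr_sumr big_split /= sumr_const card_ord -mulr_sumr sum_coord_sqr.
set r := (sqnorm z)%:~R in z2R *.
have s0 : r + 1 != 0 by rewrite gt_eqF //; lra.
have r0 : r != 0 by rewrite gt_eqF //; lra.
rewrite -(mulr_natl (2 / (r + 1) ^+ 2)) (invfM d%:R) -[leRHS]mulrA.
rewrite ler_pM2l ?invr_gt0 // -subr_ge0.
have -> : r ^- 2 * (2 * d%:R) -
    (d%:R * (2 / (r + 1) ^+ 2) + 1944 / (r + 1) ^+ 4 * r) =
    (2 * d%:R * (2 * r + 1) * (r + 1) ^+ 2 - 1944 * r ^+ 3) /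
    (r ^+ 2 * (r + 1) ^+ 4) by field; rewrite r0 s0.
apply: divr_ge0; last by rewrite mulr_ge0 ?exprn_ge0 //; lra.
rewrite subr_ge0.
(* Here [2 * d >= 972], and [1944 = 972 * 2] matches the leading term in [r]. *)
apply: (le_trans (y := 972 * (2 * r + 1) * (r + 1) ^+ 2)).
  nra.
by rewrite !ler_wpM2r ?exprn_ge0 //; lra.
Qed.

(** * Sums of inverse squares *)

(** Telescoping: [1 / (M + 1)^2 <= 1 / M - 1 / (M + 1)]. *)
Lemma sum_iota_inv_sqr_le (R : realFieldType) (M : nat) :
  \sum_(m <- iota 1 M.+1) (m%:R ^+ 2)^-1 <= 2 - (M.+1%:R)^-1 :> R.
Proof.
elim: M => [|M IH]; first by rewrite big_seq1 expr1n invr1; lra.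
rewrite -[in iota _ _](addn1 M.+1) iotaD big_cat big_seq1 add1n /=.
apply: le_trans (lerD IH (lexx _)) _.
have M0 : 0 < M.+1%:R :> R by rewrite ltr0n.
rewrite -(natr1 M.+1).
move: (M.+1%:R) M0 => x M0.
have x0 : x != 0 by rewrite gt_eqF.
have x1 : x + 1 != 0 by rewrite gt_eqF //; lra.
rewrite -subr_ge0.
have -> : 2 - (x + 1)^-1 - (2 - x^-1 + (x + 1) ^- 2) = (x * (x + 1) ^+ 2)^-1.
  by field; rewrite x1 x0.
by rewrite invr_ge0 mulr_ge0 ?exprn_ge0 //; lra.
Qed.

Lemma sum_inv_sqr_le (R : realFieldType) (t : seq nat) :
  uniq t -> (forall m, m \in t -> (0 < m)%N) ->
  \sum_(m <- t) (m%:R ^+ 2)^-1 <= 2 :> R.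
Proof.
move=> ut t0; set M := (\max_(m <- t) m)%N.
have tM m : m \in t -> m \in iota 1 M.+1.
  by move=> mt; rewrite mem_iota t0 //= ltnS leqW // leq_bigmax_seq.
rewrite (perm_big [seq m <- iota 1 M.+1 | m \in t]); last first.
  apply: uniq_perm; rewrite ?filter_uniq ?iota_uniq // => m.
  by rewrite mem_filter andb_idr //; exact: tM.
rewrite big_filter.
apply: (le_trans (y := \sum_(m <- iota 1 M.+1) (m%:R ^+ 2)^-1)).
  rewrite [leRHS](bigID (mem t)) /= lerDl.
  by apply: sumr_ge0 => m _; rewrite invr_ge0 sqr_ge0.
apply: le_trans (sum_iota_inv_sqr_le R M) _.
by rewrite lerBlDr lerDl invr_ge0.
Qed.

Lemma sum_inv_sqr_dist_le (R : realFieldType) (k : nat) (t : seq nat) :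
  uniq t -> k \notin t ->
  \sum_(j <- t) (((k%:Z - j%:Z)%:~R ^+ 2)^-1) <= 4 :> R.
Proof.
move=> ut kt.
rewrite (bigID (fun j => j < k)%N) /= (_ : 4 = 2 + 2 :> R); last first.
  by ring.
apply: lerD.
  apply: le_trans (sum_inv_sqr_le R (t := [seq k - j | j <- t & j < k]%N) _ _).
  - rewrite big_map big_filter le_eqVlt; apply/orP; left; apply/eqP.
    by apply: eq_bigr => j jk; rewrite subzn 1?ltnW.
  - rewrite map_inj_in_uniq ?filter_uniq // => i j.
    by rewrite !mem_filter => /andP[ik _] /andP[jk _]; lia.
  - by move=> m /mapP[j]; rewrite mem_filter => /andP[jk _] ->; lia.
apply: le_trans
  (sum_inv_sqr_le R (t := [seq j - k | j <- t & ~~ (j < k)]%N) _ _).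
- rewrite big_map big_filter le_eqVlt; apply/orP; left; apply/eqP.
  apply: eq_bigr => j; rewrite -leqNgt => kj.
  by rewrite -opprB subzn // rmorphN sqrrN.
- rewrite map_inj_in_uniq ?filter_uniq // => i j.
  by rewrite !mem_filter => /andP[ik _] /andP[jk _]; lia.
- move=> m /mapP[j]; rewrite mem_filter => /andP[kj jt] ->.
  have : j != k by apply: contraNneq kt => <-.
  lia.
Qed.

(** Combines [|z|_2^2 >= |z|_1] with the triangle inequality for [|.|_1]. *)
Lemma potential_le (R : realType) (d : nat) (x y : lattice d) :
  l1norm x != l1norm y ->
  potential R (x - y) <=
  d%:R^-1 * (((l1norm x)%:Z - (l1norm y)%:Z)%:~R ^+ 2)^-1.
Proof.
move=> xy.
have xy0 : x - y != 0 by rewrite subr_eq0; apply: contraNneq xy => ->.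
rewrite potentialE // invfM ler_wpM2l ?invr_ge0 //.
set a := (l1norm x)%:Z - (l1norm y)%:Z.
have a0 : 0 < `|a| by rewrite normr_gt0 subr_eq0 eqz_nat.
have aq : `|a| <= sqnorm (x - y).
  exact: le_trans (l1norm_distB x y) (l1norm_le_sqnorm _).
have -> : a%:~R ^+ 2 = `|a|%:~R ^+ 2 :> R by rewrite intr_norm real_normK.
have a0R : 0 < `|a|%:~R :> R by rewrite ltr0z.
have aqR : `|a|%:~R <= (sqnorm (x - y))%:~R :> R by rewrite ler_int.
by rewrite lef_pV2 ?posrE ?exprn_gt0 ?ler_sqr ?nnegrE //; lra.
Qed.

Lemma sum_potential_le (R : realType) (d : nat) (x : lattice d) s :
  uniq (map (@l1norm d) (x :: s)) ->
  \sum_(y <- s) potential R (x - y) <= 4 / d%:R.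
Proof.
move=> /= /andP[xs us].
apply: (le_trans (y := \sum_(y <- s) d%:R^-1 *
                       (((l1norm x)%:Z - (l1norm y)%:Z)%:~R ^+ 2)^-1)).
  rewrite big_seq [leRHS]big_seq; apply: ler_sum => y ys; apply: potential_le.
  by apply: contraNneq xs => ->; apply: map_f.
rewrite -mulr_sumr mulrC ler_wpM2r ?invr_ge0 //.
have := sum_inv_sqr_dist_le R us xs; by rewrite big_map.
Qed.

(** * A superharmonic bound on the covering probability *)

(** The sum over all enumerations [y_1, ..., y_n] of [s] of the products of the
    [potential (y_i - y_(i+1))] with [y_0 = x]; the argument [n], meant to be
    [size s], only serves to make the recursion structural. *)
Fixpoint cover_bound_rec (R : realType) (d n : nat) (s : seq (lattice d))
    (x : lattice d) : R :=
  if n is m.+1 then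
    \sum_(y <- s) potential R (x - y) * cover_bound_rec R m (rem y s) y
  else 1.

Definition cover_bound (R : realType) (d : nat) (s : seq (lattice d)) x : R :=
  cover_bound_rec R (size s) s x.

Lemma cover_bound_nil (R : realType) (d : nat) (x : lattice d) :
  cover_bound R [::] x = 1.
Proof. by []. Qed.

Lemma cover_boundE (R : realType) (d : nat) (s : seq (lattice d)) x :
  s != [::] ->
  cover_bound R s x =
  \sum_(y <- s) potential R (x - y) * cover_bound R (rem y s) y.
Proof.
move=> s0; rewrite /cover_bound.
have -> : size s = (size s).-1.+1 by case: s s0.
rewrite /= big_seq [RHS]big_seq; apply: eq_bigr => y ys.
by rewrite size_rem.
Qed.

Lemma cover_bound_ge0 (R : realType) (d : nat) (s : seq (lattice d)) x :
  0 <= cover_bound R s x.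
Proof.
rewrite /cover_bound; move: (size s) => n; elim: n s x => //= n IH s x.
by apply: sumr_ge0 => y _; rewrite mulr_ge0 ?potential_ge0.
Qed.

(** The enumerations of [s] that start with [x] already account for the
    left-hand side, because [potential 0 = 1]. *)
Lemma cover_bound_rem (R : realType) (d : nat) (s : seq (lattice d)) x :
  x \in s -> cover_bound R (rem x s) x <= cover_bound R s x.
Proof.
move=> xs; rewrite [leRHS]cover_boundE; last by case: s xs.
rewrite (big_rem x) //= subrr potential0 mul1r lerDl.
by apply: sumr_ge0 => y _; rewrite mulr_ge0 ?potential_ge0 ?cover_bound_ge0.
Qed.

(** The variable [x] only enters through the factors [potential (x - y)] with
    [y] in [s], each of which is superharmonic off [y]. *)
Lemma cover_bound_superharmonic (R : realType) (d : nat)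
    (s : seq (lattice d)) x :
  (486 <= d)%N -> x \notin s ->
  (2 * d)%:R^-1 * (\sum_(u : bool * 'I_d) cover_bound R s (x + step u.1 u.2)) <=
  cover_bound R s x.
Proof.
move=> d486 xs.
have [->|s0] := eqVneq s [::].
  rewrite cover_bound_nil sumr_const card_prod card_bool card_ord.
  by rewrite mulVf // pnatr_eq0 muln_eq0; lia.
under eq_bigr do rewrite cover_boundE //.
rewrite exchange_big mulr_sumr /= [leRHS]cover_boundE //.
rewrite big_seq [leRHS]big_seq; apply: ler_sum => y ys.
rewrite -mulr_suml mulrA ler_wpM2r ?cover_bound_ge0 //.
under eq_bigr do rewrite addrAC.
apply: potential_superharmonic => //.
by rewrite subr_eq0; apply: contraNneq xs => ->.
Qed.

(** Every partial enumeration sees its next point through a sum bounded by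
    [sum_potential_le], whatever points have been used before. *)
Lemma cover_bound_le (R : realType) (d : nat) (s : seq (lattice d)) x :
  uniq (map (@l1norm d) (x :: s)) ->
  cover_bound R s x <= (4 / d%:R) ^+ size s.
Proof.
move En : (size s) => n; elim: n s x En => [|n IH] s x En us.
  by rewrite (size0nil En) expr0.
rewrite cover_boundE; last by case: s En {us}.
have c0 : 0 <= (4 / d%:R) ^+ n :> R by rewrite exprn_ge0 // divr_ge0.
apply: (le_trans (y := \sum_(y <- s) potential R (x - y) * (4 / d%:R) ^+ n)).
  rewrite big_seq [leRHS]big_seq; apply: ler_sum => y ys.
  apply: ler_wpM2l; first exact: potential_ge0.
  apply: IH; first by rewrite size_rem // En.
  rewrite -(perm_uniq (perm_map _ (perm_to_rem ys))).
  by move: us => /= /andP[].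
by rewrite -mulr_suml exprS ler_wpM2r // sum_potential_le.
Qed.

(** * Events of the random walk *)

Lemma measurable_visit (disp : measure_display) (T : measurableType disp)
    (R : realType) (P : probability T R) (d : nat)
    (X : nat -> {RV P >-> lattice d}) n x :
  measurable (X n @^-1` [set x]).
Proof. exact: measurable_funPTI. Qed.

Lemma measurable_increment (disp : measure_display) (T : measurableType disp)
    (R : realType) (P : probability T R) (d : nat)
    (X : nat -> {RV P >-> lattice d}) n e :
  measurable (increment X n @^-1` [set e]).
Proof.
rewrite (_ : _ @^-1` _ =
    \bigcup_y (X n @^-1` [set y] `&` X n.+1 @^-1` [set e + y])).
  apply: countable_bigcupT_measurable.
    exact: (countableP (setT : set 'rV[int]_d)).
  by move=> y; apply: measurableI; exact: measurable_visit.
apply/seteqP; split => t /=.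
  by move=> <-; exists (X n t) => //=; rewrite /increment subrK.
by case=> y _ [/= Xn Xn1]; rewrite /increment Xn Xn1 addrK.
Qed.

Lemma measure_bigcup_fintype (disp : measure_display) (T : measurableType disp)
    (R : realType) (mu : {measure set T -> \bar R}) (I : finType)
    (F : I -> set T) :
  trivIset setT F -> (forall i, measurable (F i)) ->
  mu (\bigcup_i F i) = (\sum_i mu (F i))%E.
Proof.
move=> trivF mF; rewrite measure_fin_bigcup //; last exact: finite_finset.
have -> : [set: I] = [set` enum I].
  by apply/seteqP; split => i // _; rewrite /= mem_enum.
by rewrite -fsbig_seq ?enum_uniq // big_enum.
Qed.

Lemma trivIset_increment_step (disp : measure_display)
    (T : measurableType disp) (R : realType) (P : probability T R) (d : nat)
    (X : nat -> {RV P >-> lattice d}) n :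
  trivIset setT
    (fun u : bool * 'I_d => increment X n @^-1` [set step u.1 u.2]).
Proof.
move=> u v _ _ [t [/= tu tv]]; apply: step_inj.
by rewrite -tu -tv.
Qed.

(** The [2 d] unit steps have total probability [1], so no other increment
    contributes. *)
Lemma probability_increment_cases (disp : measure_display)
    (T : measurableType disp) (R : realType) (P : probability T R) (d : nat)
    (X : nat -> {RV P >-> lattice d}) n (B : set T) :
  (0 < d)%N -> simple_random_walk_from_origin X -> measurable B ->
  (P B <= \sum_(u : bool * 'I_d)
            P (B `&` increment X n @^-1` [set step u.1 u.2]))%E.
Proof.
move=> d0 [_ hstep _] mB.
have mstep (u : bool * 'I_d) :
    measurable (increment X n @^-1` [set step u.1 u.2]).
  exact: measurable_increment.
have triv := trivIset_increment_step (X := X) (n := n).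
set U := \bigcup_(u : bool * 'I_d) increment X n @^-1` [set step u.1 u.2].
have mU : measurable U by exact: fin_bigcup_measurable.
have PU : P U = 1%E.
  rewrite measure_bigcup_fintype //.
  rewrite (eq_bigr (fun=> ((2 * d)%:R^-1)%:E)) => [|u _]; last first.
    by apply: hstep; exact: l1norm_step.
  rewrite sumEFin sumr_const card_prod card_bool card_ord.
  rewrite -(mulr_natr (2 * d)%:R^-1) mulVf //.
  by rewrite pnatr_eq0 muln_eq0; lia.
rewrite -measure_bigcup_fintype; last 2 first.
  - exact: trivIset_setIl.
  - by move=> u; exact: measurableI.
rewrite -setI_bigcupr -/U.
have PUC : P (~` U) = 0%E by rewrite probability_setC // PU subee.
have mBU : measurable (B `&` U) by exact: measurableI.
rewrite -(measureU0 mBU (measurableC mU) PUC).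
apply: le_measure; rewrite ?inE //.
  by apply: measurableU => //; exact: measurableC.
by move=> t Bt; have [Ut|Ut] := pselect (U t); [left|right].
Qed.

(** The steps are listed with the most recent one first, so that extending the
    history is a [cons]. *)
Fixpoint history (disp : measure_display) (T : measurableType disp)
    (R : realType) (P : probability T R) (d : nat)
    (X : nat -> {RV P >-> lattice d}) (w : seq (lattice d)) : set T :=
  if w is e :: w' then
    history X w' `&` increment X (size w') @^-1` [set e]
  else X 0%N @^-1` [set 0].

Lemma measurable_history (disp : measure_display) (T : measurableType disp)
    (R : realType) (P : probability T R) (d : nat)
    (X : nat -> {RV P >-> lattice d}) w :
  measurable (history X w).
Proof.
elim: w => [|e w IH] /=; first exact: measurable_visit.
by apply: measurableI => //; exact: measurable_increment.
Qed.

Lemma history_position (disp : measure_display) (T : measurableType disp)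
    (R : realType) (P : probability T R) (d : nat)
    (X : nat -> {RV P >-> lattice d}) w t :
  history X w t -> X (size w) t = \sum_(e <- w) e.
Proof.
elim: w => [|e w IH] /=; first by rewrite big_nil.
by case=> /IH Xw; rewrite big_cons -Xw => <-; rewrite /increment subrK.
Qed.

Lemma history_increment (disp : measure_display) (T : measurableType disp)
    (R : realType) (P : probability T R) (d : nat)
    (X : nat -> {RV P >-> lattice d}) w t i :
  history X w t -> (i < size w)%N ->
  increment X i t = nth 0 w (size w - i.+1).
Proof.
elim: w => //= e w IH [hw he].
rewrite ltnS leq_eqVlt => /predU1P[->|iw]; first by rewrite subnn.
by rewrite IH // subSn.
Qed.

Lemma probability_history (disp : measure_display) (T : measurableType disp)
    (R : realType) (P : probability T R) (d : nat)
    (X : nat -> {RV P >-> lattice d}) w :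
  simple_random_walk_from_origin X -> all (fun e => l1norm e == 1%N) w ->
  (P (history X w) <= (((2 * d)%:R^-1) ^+ size w)%:E)%E.
Proof.
move=> [_ hstep indep] /allP w1.
set J := [fset i in iota 0 (size w)]%fset.
set A := fun i => [set nth 0 w (size w - i.+1)].
have JE i : i \in J = (i < size w)%N by rewrite !inE mem_iota.
apply: (le_trans (y := P (\bigcap_(i in [set` J]) (increment X i @^-1` A i)))).
  apply: le_measure; rewrite ?inE; first exact: measurable_history.
    apply: fin_bigcap_measurable; first exact: finite_fset.
    by move=> i _; exact: measurable_increment.
  move=> t ht i; rewrite /= JE => iw.
  by rewrite /A /=; exact: history_increment.
rewrite indep // (eq_big_seq (fun=> ((2 * d)%:R^-1)%:E)) => [|i].
  have sJ : size J = size w.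
    rewrite -(size_iota 0 (size w)); apply/perm_size/uniq_perm => [||i].
    - exact: fset_uniq.
    - exact: iota_uniq.
    - by rewrite JE mem_iota.
  by rewrite prodEFin big_const_seq count_predT iter_mulr_1 sJ.
rewrite JE => iw; rewrite /A hstep //; apply/eqP/w1/mem_nth.
by rewrite ltn_subrL (leq_ltn_trans _ iw).
Qed.

Definition visited (disp : measure_display) (T : measurableType disp)
    (R : realType) (P : probability T R) (d : nat)
    (X : nat -> {RV P >-> lattice d}) (a b : nat) (s : seq (lattice d)) :
    set T :=
  [set t | forall y, y \in s -> exists2 n, (a < n <= b)%N & X n t = y].

Lemma measurable_visited (disp : measure_display) (T : measurableType disp)
    (R : realType) (P : probability T R) (d : nat)
    (X : nat -> {RV P >-> lattice d}) a b s :
  measurable (visited X a b s).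
Proof.
rewrite (_ : visited X a b s = \bigcap_(y in [set` s])
    \bigcup_(n in [set n | (a < n <= b)%N]) X n @^-1` [set y]).
  apply: fin_bigcap_measurable; first exact: finite_seq.
  by move=> y _; apply: bigcup_measurable => n _; exact: measurable_visit.
by [].
Qed.

(** The supermartingale argument, as an induction on the number [m] of steps
    still to be made: condition on the next step, cross out the point it
    reaches if that point belongs to [s], and average with
    [cover_bound_superharmonic].  For
    [m = 0] the event is impossible unless [s] is empty. *)
Lemma probability_history_visited (disp : measure_display)
    (T : measurableType disp) (R : realType) (P : probability T R) (d : nat)
    (X : nat -> {RV P >-> lattice d}) m (w s : seq (lattice d)) :
  (486 <= d)%N -> simple_random_walk_from_origin X ->
  all (fun e => l1norm e == 1%N) w -> uniq s -> \sum_(e <- w) e \notin s ->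
  (P (history X w `&` visited X (size w) (size w + m) s) <=
   ((2 * d)%:R^-1 ^+ size w * cover_bound R s (\sum_(e <- w) e))%:E)%E.
Proof.
move=> d486 hX.
have d0 : (0 < d)%N by lia.
have c0 : 0 <= (2 * d)%:R^-1 :> R by rewrite invr_ge0.
elim: m w s => [|m IH] w s w1 us ws.
  have [->|s0] := eqVneq s [::].
    rewrite cover_bound_nil mulr1; apply: le_trans (probability_history hX w1).
    apply: le_measure; rewrite ?inE.
    - apply: measurableI; first exact: measurable_history.
      exact: measurable_visited.
    - exact: measurable_history.
    - exact: subIsetl.
  rewrite (_ : _ `&` _ = set0).
    by rewrite measure0 lee_fin mulr_ge0 ?exprn_ge0 ?cover_bound_ge0.
  apply/seteqP; split => // t [_ vt].
  have [y ys] : exists y, y \in s.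
    by case: s s0 {us ws vt} => // y s; exists y; rewrite mem_head.
  by have [n] := vt y ys; rewrite addn0 => /andP[]; lia.
have mB : measurable (history X w `&` visited X (size w) (size w + m.+1) s).
  by apply: measurableI; [exact: measurable_history|exact: measurable_visited].
apply: le_trans (probability_increment_cases (size w) d0 hX mB) _.
apply: (le_trans (y := (\sum_(u : bool * 'I_d)
  ((2 * d)%:R^-1 ^+ (size w).+1 *
   cover_bound R s (\sum_(e <- w) e + step u.1 u.2))%:E)%E)); last first.
  rewrite sumEFin lee_fin -mulr_sumr exprSr -mulrA ler_wpM2l ?exprn_ge0 //.
  exact: cover_bound_superharmonic.
apply: lee_sum => u _.
set x := _ + _; set w' := step u.1 u.2 :: w.
have xE : \sum_(e <- w') e = x by rewrite big_cons addrC.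
have xs : x \notin rem x s by rewrite mem_rem_uniqF.
apply: (le_trans (y := P (history X w' `&`
    visited X (size w') (size w' + m) (rem x s)))).
  apply: le_measure; rewrite ?inE.
  - by apply: measurableI => //; exact: measurable_increment.
  - apply: measurableI; first exact: measurable_history.
    exact: measurable_visited.
  move=> t [[ht vt] it]; split; first by split.
  move=> y; rewrite mem_rem_uniq // inE => /andP[yx ys].
  have [n /andP[wn nm] Xn] := vt y ys.
  exists n => //; apply/andP; split; last by rewrite /= addSnnS.
  rewrite ltn_neqAle wn andbT; apply: contraNneq yx => wn'.
  by rewrite -Xn -wn' -xE -(@history_position _ _ _ _ _ X w' t).
apply: le_trans (IH _ _ _ _ _) _; rewrite ?xE ?rem_uniq //=.
  by rewrite l1norm_step.
rewrite lee_fin ler_wpM2l ?exprn_ge0 //.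
by have [xs'|xs'] := boolP (x \in s); [exact: cover_bound_rem|rewrite rem_id].
Qed.

Lemma measurable_cover (disp : measure_display) (T : measurableType disp)
    (R : realType) (P : probability T R) (d : nat)
    (X : nat -> {RV P >-> lattice d}) (s : seq (lattice d)) :
  measurable [set t | forall y, y \in s -> exists n, X n t = y].
Proof.
rewrite (_ : mkset _ = \bigcap_(y in [set` s]) \bigcup_n X n @^-1` [set y]).
  apply: fin_bigcap_measurable; first exact: finite_seq.
  by move=> y _; apply: bigcupT_measurable => n; exact: measurable_visit.
apply/seteqP; split => t /= ht y /ht.
  by case=> n Xn; exists n.
by case=> n _ Xn; exists n.
Qed.

(** A finite set that is visited at all is visited within a bounded time. *)
Lemma visited_cover (disp : measure_display) (T : measurableType disp)
    (R : realType) (P : probability T R) (d : nat)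
    (X : nat -> {RV P >-> lattice d}) (s : seq (lattice d)) t :
  X 0%N t \notin s -> (forall y, y \in s -> exists n, X n t = y) ->
  exists m, visited X 0 m s t.
Proof.
elim: s => [|y s IH]; first by move=> _ _; exists 0%N.
rewrite inE negb_or => /andP[Xy Xs] ht.
have [|m hm] := IH Xs; first by move=> z zs; apply: ht; rewrite inE zs orbT.
have [n Xn] := ht y (mem_head y s).
exists (maxn m n) => z; rewrite inE => /predU1P[->|/hm].
  exists n => //; rewrite leq_maxr andbT lt0n.
  by apply: contraNneq Xy => n0; rewrite -Xn n0.
by case=> k /andP[k0 km] Xk; exists k => //; rewrite k0 leq_max km.
Qed.

(** The bound of [probability_history_visited] from the empty history does not
    depend on the horizon [m], so it passes to the limit. *)
Lemma probability_cover_le (disp : measure_display)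
    (T : measurableType disp) (R : realType) (P : probability T R) (d : nat)
    (X : nat -> {RV P >-> lattice d}) (s : seq (lattice d)) :
  (486 <= d)%N -> simple_random_walk_from_origin X -> uniq s -> 0 \notin s ->
  (P [set t | forall y, y \in s -> exists n, X n t = y] <=
   (cover_bound R s 0)%:E)%E.
Proof.
move=> d486 hX us s0; set C := mkset _.
have mC : measurable C by exact: measurable_cover.
have mX0 := measurable_history X [::].
set E := fun m => history X [::] `&` visited X 0 m s.
have mE m : measurable (E m).
  by apply: measurableI => //; exact: measurable_visited.
have mUE : measurable (\bigcup_m E m) by exact: bigcupT_measurable.
have C_sub : C `<=` \bigcup_m E m `|` ~` history X [::].
  move=> t Ct; have [X0|X0] := pselect (history X [::] t); last by right.
  left; have [|m hm] := visited_cover (X := X) (s := s) (t := t) _ Ct.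
    by rewrite (X0 : X 0%N t = 0).
  by exists m.
have PX0C : P (~` history X [::]) = 0%E.
  by rewrite probability_setC //=; case: hX => -> _ _; rewrite subee.
apply: (le_trans (y := P (\bigcup_m E m))).
  rewrite -(measureU0 mUE (measurableC mX0) PX0C).
  apply: le_measure; rewrite ?inE //.
  by apply: measurableU => //; exact: measurableC.
have cvgE : P (E m) @[m --> \oo] --> P (\bigcup_m E m).
  apply: nondecreasing_cvg_mu => // m n mn; apply/subsetPset.
  apply: setIS => t ht y /ht[k /andP[k0 km] Xk].
  by exists k => //; rewrite k0 (leq_trans km).
rewrite -(cvg_lim _ cvgE) //; apply: lime_le.
  by apply/cvg_ex; exists (P (\bigcup_m E m)).
apply: nearW => m.
have := @probability_history_visited _ _ _ P d X m [::] s d486 hX isT us.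
by rewrite big_nil add0n expr0 mul1r => /(_ s0).
Qed.

(** * Covering a path *)

(** A discrete intermediate value theorem. *)
Lemma path_meets_spheres (d K : nat) (p : 'I_K.+1 -> lattice d) i k :
  nearest_neighbor_path p -> p ord0 = 0 -> (k <= l1norm (p i))%N ->
  exists j, l1norm (p j) = k.
Proof.
move=> pnn p0; case: i => n; elim: n => [|n IH] nK kp.
  exists ord0; move: kp; rewrite (_ : Ordinal nK = ord0); last exact: val_inj.
  rewrite p0; have /eqP -> : l1norm (0 : lattice d) == 0%N.
    by rewrite l1norm_eq0.
  by rewrite leqn0 => /eqP.
have nK' : (n < K.+1)%N by exact: ltnW.
have [kn|nk] := leqP k (l1norm (p (Ordinal nK'))); first exact: IH kn.
exists (Ordinal nK); apply/eqP; rewrite eqn_leq kp andbT.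
have := l1norm_sub (p (Ordinal nK)) (p (Ordinal nK')).
by rewrite pnn // add1n => /leq_trans -> .
Qed.

Theorem theorem1p6 (R : realType) :
  exists C : R, 0 < C /\
    forall (d : nat), (4 <= d)%N ->
    forall (N : nat), (1 <= N)%N ->
    forall (K : nat) (p : 'I_K.+1 -> lattice d),
      nearest_neighbor_path p -> connects_origin_to_sphere N p ->
    forall (disp : measure_display) (T : measurableType disp)
           (P : probability T R) (X : nat -> {RV P >-> lattice d}),
      simple_random_walk_from_origin X ->
      (P [set w | range p `<=` range (fun n => X n w)]
         <= ((C / d%:R) ^+ N)%:E)%E.
Proof.
exists 486; split; first by rewrite ltr0n.
move=> d d4 N N1 K p pnn [p0 pN _] disp T P X hX.
have d0 : 0 < d%:R :> R by rewrite ltr0n; lia.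
have cover_eq : [set w | range p `<=` range (fun n => X n w)] =
    [set w | forall y, y \in map p (enum 'I_K.+1) -> exists n, X n w = y].
  apply/seteqP; split => w /= hw y.
    by case/mapP => i _ ->; have [n _ Xn] := hw (p i) (imageT p i); exists n.
  case=> i _ <-; have [|n Xn] := hw (p i); first by rewrite map_f ?mem_enum.
  by exists n.
rewrite cover_eq.
have [d486|d486] := leqP 486 d; last first.
  apply: le_trans (probability_le1 _ _) _; first exact: measurable_cover.
  by rewrite lee_fin exprn_ege1 // ler_pdivlMr // mul1r (ler_nat R d 486) ltnW.
have /boolp.choice[x xP] : forall k, exists x : lattice d, (k <= N)%N ->
    x \in map p (enum 'I_K.+1) /\ l1norm x = k.
  move=> k; have [kN|kN] := leqP k N; last by exists 0.
  have [|j pj] := path_meets_spheres (i := ord_max) (k := k) pnn p0.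
    by rewrite (pN : l1norm (p ord_max) = N).
  by exists (p j) => _; split; rewrite ?map_f ?mem_enum.
set s := map x (iota 1 N).
have sN : size s = N by rewrite size_map size_iota.
have l1s : map (@l1norm d) s = iota 1 N.
  rewrite -map_comp -[RHS]map_id; apply/eq_in_map => k.
  by rewrite mem_iota add1n ltnS => /andP[_ /xP[]].
have l1_0s : map (@l1norm d) (0 :: s) = iota 0 N.+1.
  by rewrite /= l1s; congr cons; apply/eqP; rewrite l1norm_eq0.
have u0s : uniq (map (@l1norm d) (0 :: s)) by rewrite l1_0s iota_uniq.
have /= /andP[s0 us] := map_uniq u0s.
apply: (le_trans (y := P [set w | forall y, y \in s -> exists n, X n w = y])).
  apply: le_measure; rewrite ?inE; try exact: measurable_cover.
  move=> w hw y /mapP[k]; rewrite mem_iota add1n ltnS => /andP[_ kN] ->.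
  by apply: hw; have [] := xP k kN.
apply: le_trans (probability_cover_le d486 hX us s0) _.
rewrite lee_fin; apply: le_trans (cover_bound_le R u0s) _.
have le4 : 4 / d%:R <= 486 / d%:R :> R.
  by rewrite ler_pM2r ?invr_gt0 // (ler_nat R 4 486).
rewrite sN lerXn2r // nnegrE; last apply: le_trans le4.
all: by rewrite divr_ge0 // ltW.
Qed.
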